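(* Let $V,T$ be finite-dimensional complex vector spaces. For $s=\sum_{l\ge1}s_lz^{-l}\in\mathfrak g_-$ and a family $(M_{a,b})_{a,b\ge0}$ of $\mathrm{End}(V)$-valued formal power series in $t\in T$, put $$(s.M)_{a,b}=\sum_{l\ge1}\Bigl[s_lM_{a-l,b}-(-1)^lM_{a,b-l}s_l+(-1)^b\delta_{a+b+1,l}\,s_l\Bigr],$$ where by convention $M_{a,b}=0$ if one of its indices is negative. This gives a well-defined Lie algebra action of $\mathfrak g_-$ on (matrix) Gromov-Witten potentials. It preserves the master equations $$dM_{a+1,b}=M_{a,0}\,dM_{0,b},\qquad dM_{a,b+1}=dM_{a,0}\,M_{0,b},\qquad M_{a+1,b}+M_{a,b+1}=M_{a,0}M_{0,b}\qquad(a,b\ge0)$$ and can be integrated to a well-defined group action of $G_-$.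
   Context: $G_-$ is the group of formal power series $S(z^{-1})$ with values in $\mathrm{End}(V)$ such that $S=\mathrm{id}$ at $1/z=0$; its Lie algebra $\mathfrak g_-$ consists of the formal power series $s=\sum_{l\ge1}s_lz^{-l}$, $s_l\in\mathrm{End}(V)$. Here (matrix) Gromov-Witten potentials are families $(M_{a,b})_{a,b\ge0}$ of $\mathrm{End}(V)$-valued power series in $t$ (constant terms are allowed); $d=d_t$ is the differential in $t$. The element $s.M$ is the infinitesimal change $M\mapsto M+\varepsilon\,(s.M)$; being a Lie algebra action means that if $X_s(M)=s.M$, then $DX_s[X_{s'}]-DX_{s'}[X_s]=X_{[s,s']}$, where $D$ is the derivative with respect to $M$. Preserving the master equations means that $s.M$ satisfies the linearization of these equations at any solution $M$ (equivalently, the group action takes solutions to solutions). The group action is obtained by exponentiation: $S=e^s$ acts by the time-one flow of $\frac{dM}{d\varepsilon}=s.M$. In terms of the full Gromov-Witten potential $F(p,q,t)=\sum_{a,b\ge0}\langle p_a,M_{a,b}(t)q_b\rangle$, $q_b\in V$, $p_a\in V^*$, the same action on $e^F$ is given by the differential operator $$\widehat s=\sum_{l\ge1}\Bigl[\sum_{a\ge0}(s_l)^\nu_\mu p_{a+l,\nu}\frac{\partial}{\partial p_{a,\mu}}-(-1)^l\sum_{b\ge0}(s_l)^\nu_\mu q^\mu_{b+l}\frac{\partial}{\partial q^\nu_b}+\sum_{i+j=l-1}(-1)^j(s_l)^\nu_\mu p_{i,\nu}q^\mu_j\Bigr]$$ (coordinates in a basis of $V$ and the dual basis, $s_le_\mu=(s_l)_\mu^\nu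 e_\nu$, summation over repeated indices). *)

(* Defs.v *)
From HB Require Import structures.
From mathcomp Require Import all_boot all_order all_algebra.
From mathcomp.real_closed Require Import complex.
From mathcomp.multinomials Require Import -(notations) mpoly.
From mathcomp Require Import boolp classical_sets functions cardinality fsbigop.
From mathcomp Require Import reals topology normedtype derive.

Set Implicit Arguments.
Unset Strict Implicit.
Unset Printing Implicit Defensive.

Import Order.TTheory GRing.Theory Num.Theory.
Import numFieldNormedType.Exports.

Local Open Scope classical_set_scope.
Local Open Scope complex_scope.
Local Open Scope ring_scope.

(* Formal power series in z^-1 with values in End(V): the coefficient of
   z^-l is s l.  The ring structure is the one of 'End(V)[[z^-1]], with
   composition as product of 'End(V); it may be the zero ring. *)
Definition zseries (R : realType) (V : vectType R[i]) := nat -> 'End(V).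

Section ZSeriesRing.
Variables (R : realType) (V : vectType R[i]).
Local Notation zser := (zseries V).

HB.instance Definition _ := GRing.Lmodule.copy zser (nat -> 'End(V)).

Definition zone : zser := fun k => if k == 0%N then \1%VF else 0.

Definition zmul (s s' : zser) : zser :=
  fun k => \sum_(i < k.+1) (s i \o s' (k - i)%N)%VF.

Let comp_suml I (r : seq I) (P : pred I) (F : I -> 'End(V)) (g : 'End(V)) :
  ((\sum_(i <- r | P i) F i) \o g = \sum_(i <- r | P i) (F i \o g))%VF.
Proof.
by apply: (big_morph (fun f => f \o g)%VF) => [f h|]; rewrite ?comp_lfunDl ?comp_lfun0l.
Qed.

Let comp_sumr I (r : seq I) (P : pred I) (F : I -> 'End(V)) (g : 'End(V)) :
  (g \o (\sum_(i <- r | P i) F i) = \sum_(i <- r | P i) (g \o F i))%VF.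
Proof.
by apply: (big_morph (fun f => g \o f)%VF) => [f h|]; rewrite ?comp_lfunDr ?comp_lfun0r.
Qed.

Let zmul_rev (s t : zser) k :
  zmul s t k = \sum_(i < k.+1) (s (k - i)%N \o t i)%VF.
Proof.
rewrite /zmul (reindex_inj rev_ord_inj) /=.
by apply: eq_bigr => i _; rewrite (sub_ordK i).
Qed.

Let zmulA : associative zmul.
Proof.
move=> s t u; apply/funext => n; rewrite [LHS]/zmul zmul_rev.
pose c j k := (s j \o (t (n - j - k)%N \o u k))%VF.
transitivity (\sum_(j < n.+1) \sum_(k < n.+1 | (k <= n - j)%N) c j k).
  apply: eq_bigr => /= j _; rewrite zmul_rev comp_sumr.
  by rewrite (big_ord_narrow_leq (leq_subr _ _)).
rewrite (exchange_big_dep predT) //=; apply: eq_bigr => k _.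
transitivity (\sum_(j < n.+1 | (j <= n - k)%N) c j k).
  apply: eq_bigl => j; rewrite -ltnS -(ltnS j) -!subSn ?leq_ord //.
  by rewrite -subn_gt0 -(subn_gt0 j) -!subnDA addnC.
rewrite (big_ord_narrow_leq (leq_subr _ _)) /zmul comp_suml /=.
by apply: eq_bigr => j _; rewrite /c subnAC comp_lfunA.
Qed.

Let zmul1l : left_id zone zmul.
Proof.
move=> s; apply/funext => k; rewrite /zmul big_ord_recl /= comp_lfun1l subn0.
by rewrite big1 ?addr0 // => i _; rewrite comp_lfun0l.
Qed.

Let zmul1r : right_id zone zmul.
Proof.
move=> s; apply/funext => k; rewrite /zmul big_ord_recr /= subnn comp_lfun1r.
rewrite big1 ?add0r // => i _.
by rewrite /zone subn_eq0 leqNgt ltn_ord comp_lfun0r.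
Qed.

Let zmulDl : left_distributive zmul +%R.
Proof.
move=> s t u; apply/funext => k; rewrite /zmul -[RHS]big_split /=.
by apply: eq_bigr => i _; rewrite comp_lfunDl.
Qed.

Let zmulDr : right_distributive zmul +%R.
Proof.
move=> s t u; apply/funext => k; rewrite /zmul -[RHS]big_split /=.
by apply: eq_bigr => i _; rewrite comp_lfunDr.
Qed.

HB.instance Definition _ :=
  GRing.Zmodule_isPzRing.Build zser zmulA zmul1l zmul1r zmulDl zmulDr.

Lemma zmulE (s t : zser) k :
  (s * t) k = \sum_(i < k.+1) (s i \o t (k - i)%N)%VF.
Proof. by []. Qed.

Lemma zaddE (s t : zser) k : (s + t) k = s k + t k. Proof. by []. Qed.
Lemma zoppE (s : zser) k : (- s) k = - s k. Proof. by []. Qed.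
Lemma zone0 : (1 : zser) 0%N = \1%VF. Proof. by []. Qed.

Lemma zmul0 (s t : zser) : (s * t) 0%N = (s 0%N \o t 0%N)%VF.
Proof. by rewrite zmulE big_ord1. Qed.

Lemma zsumE I (r : seq I) (P : pred I) (F : I -> zser) k :
  (\sum_(i <- r | P i) F i) k = \sum_(i <- r | P i) F i k.
Proof. by apply: (big_morph (fun s : zser => s k)). Qed.

Lemma zexp_low (s : zser) n k : s 0%N = 0 -> (k < n)%N -> (s ^+ n) k = 0.
Proof.
move=> s0; elim: n k => // n IHn k; rewrite ltnS => kn.
rewrite exprS zmulE big1 // => -[[|i] /= ik] _.
  by rewrite s0 comp_lfun0l.
by rewrite IHn ?comp_lfun0r //; apply: leq_trans kn; rewrite subnSK // leq_subr.
Qed.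

End ZSeriesRing.

Section LieAlgebra.
Variables (R : realType) (V : vectType R[i]).

Definition in_gminus : pred (zseries V) := fun s => s 0%N == 0.

Record gminus := Gminus { gminus_val :> zseries V; _ : in_gminus gminus_val }.

HB.instance Definition _ := [isSub for gminus_val].
HB.instance Definition _ := [Choice of gminus by <:].

Let in_gminus_submod : submod_closed in_gminus.
Proof.
split=> [|c s t]; first exact/eqP.
rewrite !unfold_in /in_gminus => /eqP s0 /eqP t0; apply/eqP.
by rewrite zaddE t0 addr0 -[LHS]/(c *: s 0%N) s0 scaler0.
Qed.

HB.instance Definition _ :=
  GRing.isSubmodClosed.Build R[i] (zseries V) in_gminus
    in_gminus_submod.
HB.instance Definition _ := [SubChoice_isSubLmodule of gminus by <:].

Lemma gminus0 (s : gminus) : gminus_val s 0%N = 0. Proof. by case: s => s /= /eqP. Qed.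

Fact lie_subproof (s t : gminus) :
  in_gminus (gminus_val s * gminus_val t - gminus_val t * gminus_val s).
Proof.
by rewrite /in_gminus zaddE zoppE !zmul0 !gminus0 !comp_lfun0l subrr.
Qed.

Definition lie (s t : gminus) : gminus := Gminus (lie_subproof s t).

End LieAlgebra.

Section Group.
Variables (R : realType) (V : vectType R[i]).

Definition in_Ggroup : pred (zseries V) := fun S => S 0%N == \1%VF.

Record Ggroup := GGroup { Ggroup_val :> zseries V; _ : in_Ggroup Ggroup_val }.

HB.instance Definition _ := [isSub for Ggroup_val].
HB.instance Definition _ := [Choice of Ggroup by <:].

Lemma Ggroup0 (S : Ggroup) : Ggroup_val S 0%N = \1%VF. Proof. by case: S => S /= /eqP. Qed.

Fact Gone_subproof : in_Ggroup 1. Proof. exact/eqP. Qed.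
Definition Gone := GGroup Gone_subproof.

Fact Gmul_subproof (S S' : Ggroup) :
  in_Ggroup (Ggroup_val S * Ggroup_val S').
Proof. by rewrite /in_Ggroup zmul0 !Ggroup0 comp_lfun1l. Qed.
Definition Gmul (S S' : Ggroup) := GGroup (Gmul_subproof S S').

(* The geometric series in 1 - S, whose n-th power starts at z^-n. *)
Definition zinv (S : zseries V) : zseries V :=
  fun k => (\sum_(n < k.+1) (1 - S) ^+ n) k.

Fact Ginv_subproof (S : Ggroup) : in_Ggroup (zinv S).
Proof. by apply/eqP; rewrite /zinv big_ord1. Qed.
Definition Ginv (S : Ggroup) := GGroup (Ginv_subproof S).

Let sub1_0 (S : Ggroup) : (1 - Ggroup_val S) 0%N = 0.
Proof. by rewrite zaddE zoppE Ggroup0 subrr. Qed.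

Let zinvE (S : Ggroup) n k : (k <= n)%N ->
  zinv S k = (\sum_(i < n.+1) (1 - Ggroup_val S) ^+ i) k.
Proof.
move=> kn; rewrite /zinv !zsumE.
rewrite (big_ord_widen n.+1 (fun i => ((1 - Ggroup_val S) ^+ i) k)) //.
rewrite big_mkcond /=; apply: eq_bigr => i _.
by case: ltnP => // ki; rewrite zexp_low //; exact: sub1_0.
Qed.

Let GmulA : associative Gmul.
Proof. by move=> S T U; apply: val_inj; apply: mulrA. Qed.
Let Gmul1l : left_id Gone Gmul.
Proof. by move=> S; apply: val_inj; apply: mul1r. Qed.
Let Gmul1r : right_id Gone Gmul.
Proof. by move=> S; apply: val_inj; apply: mulr1. Qed.

Let GmulVl : left_inverse Gone Ginv Gmul.
Proof.
move=> S; apply: val_inj; apply/funext => k /=.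
pose N := 1 - Ggroup_val S.
transitivity ((\sum_(i < k.+1) N ^+ i * Ggroup_val S) k).
  rewrite -mulr_suml !zmulE; apply: eq_bigr => i _.
  by rewrite -(@zinvE S k) // -ltnS.
have -> : Ggroup_val S = 1 - N by rewrite opprB addrC subrK.
rewrite -mulr_suml.
have -> : (\sum_(i < k.+1) N ^+ i) * (1 - N) = 1 - N ^+ k.+1.
  elim: (k.+1) => [|n IHn]; first by rewrite big_ord0 mul0r expr0 subrr.
  by rewrite big_ord_recr /= mulrDl IHn mulrBr mulr1 -exprSr addrA subrK.
by rewrite zaddE zoppE zexp_low ?subr0 //; exact: sub1_0.
Qed.

Let GmulVr : right_inverse Gone Ginv Gmul.
Proof.
move=> S; rewrite -[LHS]Gmul1l -[X in Gmul X _](GmulVl (Ginv S)).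
by rewrite -GmulA [Gmul (Ginv S) _]GmulA GmulVl Gmul1l GmulVl.
Qed.

HB.instance Definition _ :=
  isGroup.Build Ggroup GmulA Gmul1l Gmul1r GmulVl GmulVr.

(* The coefficient of z^-k in e^s; the terms n > k of the exponential series
   do not contribute to it, since s starts at z^-1. *)
Definition zexp (s : zseries V) : zseries V :=
  fun k => \sum_(n < k.+1) (n`!%:R^-1 : R[i]) *: (s ^+ n) k.

Fact Gexp_subproof (s : gminus V) : in_Ggroup (zexp s).
Proof. by apply/eqP; rewrite /zexp big_ord1 fact0 invr1 scale1r. Qed.
Definition Gexp (s : gminus V) : Ggroup := GGroup (Gexp_subproof s).

End Group.

(* Formal power series on T with values in End(V), by their coefficients in the
   linear coordinates dual to the basis vbasis {:T} of T. *)
Definition tseries (R : realType) (V T : vectType R[i]) :=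
  multinom (\dim {:T}) -> 'End(V).

Definition gwpot (R : realType) (V T : vectType R[i]) :=
  nat -> nat -> tseries V T.

Section Potentials.
Variables (R : realType) (V T : vectType R[i]).
Local Notation tser := (tseries V T).
Local Notation pot := (gwpot V T).

HB.instance Definition _ :=
  GRing.Lmodule.copy tser (multinom (\dim {:T}) -> 'End(V)).
HB.instance Definition _ := GRing.Lmodule.copy pot (nat -> nat -> tser).

Definition tconst (A : 'End(V)) : tser := fun m => if m == mnm0 then A else 0.

Definition tmul (f g : tser) : tser := fun m =>
  \sum_(k : bmultinom (\dim {:T}) (mdeg m).+1 *
            bmultinom (\dim {:T}) (mdeg m).+1
        | m == mnm_add k.1 k.2) (f k.1 \o g k.2)%VF.

Definition tpartial (j : 'I_(\dim {:T})) (f : tser) : tser :=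
  fun m => (m j).+1%:R *: f (mnm_add m (mnm1 j)).

(* The differential, as a 1-form on T: tdiff f v is the derivative of f along
   the constant vector field v. *)
Definition tdiff (f : tser) (v : T) : tser :=
  \sum_(j < \dim {:T}) coord (vbasis {:T}) j v *: tpartial j f.

Definition master_equations (M : pot) : Prop :=
  forall a b : nat,
    [/\ forall v : T, tdiff (M a.+1 b) v = tmul (M a 0%N) (tdiff (M 0%N b) v),
        forall v : T, tdiff (M a b.+1) v = tmul (tdiff (M a 0%N) v) (M 0%N b)
      & M a.+1 b + M a b.+1 = tmul (M a 0%N) (M 0%N b)].

(* N satisfies the equations for the first order variation M + eps N of M. *)
Definition linearized_master_equations (M N : pot) : Prop :=
  forall a b : nat,
    [/\ forall v : T, tdiff (N a.+1 b) v =
          tmul (N a 0%N) (tdiff (M 0%N b) v) + tmul (M a 0%N) (tdiff (N 0%N b) v),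
        forall v : T, tdiff (N a b.+1) v =
          tmul (tdiff (N a 0%N) v) (M 0%N b) + tmul (tdiff (M a 0%N) v) (N 0%N b)
      & N a.+1 b + N a b.+1 =
          tmul (N a 0%N) (M 0%N b) + tmul (M a 0%N) (N 0%N b)].

Definition act_term (s : gminus V) (M : pot) (a b l : nat) : tser :=
  tmul (tconst (gminus_val s l)) (if (l <= a)%N then M (a - l)%N b else 0)
  - (-1) ^+ l *: tmul (if (l <= b)%N then M a (b - l)%N else 0) (tconst (gminus_val s l))
  + ((-1) ^+ b *+ (a + b + 1 == l)%N) *: tconst (gminus_val s l).

Definition act_support (s : gminus V) (M : pot) (a b : nat) : set nat :=
  [set l | (1 <= l)%N /\ act_term s M a b l <> 0].

(* \sum_(l \in A) is the sum over the l in A with a nonzero term, and is 0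
   unless these are finitely many. *)
Definition act (s : gminus V) (M : pot) : pot := fun a b =>
  \sum_(l \in [set l | (1 <= l)%N]) act_term s M a b l.

(* Derivatives with respect to a real parameter are taken coefficientwise; each
   coefficient lies in the finite-dimensional complex space End(V), and is
   differentiated through the linear functionals phi on it. *)
Definition has_derivative (gamma : R -> pot) (x : R) (N : pot) : Prop :=
  forall (a b : nat) (m : multinom (\dim {:T})) (phi : 'Hom('End(V), R[i]^o)),
    is_derive x 1 (fun y => complex.Re (phi (gamma y a b m)))
      (complex.Re (phi (N a b m))) /\
    is_derive x 1 (fun y => complex.Im (phi (gamma y a b m)))
      (complex.Im (phi (N a b m))).

(* DX_M[N] = Y, for a vector field X on the space of potentials. *)
Definition has_dir_derivative (X : pot -> pot) (M N Y : pot) : Prop :=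
  has_derivative (fun eps => X (M + (eps%:C) *: N)) 0 Y.

Definition is_lie_action (X : gminus V -> pot -> pot) : Prop :=
  (forall (c : R[i]) s s' M, X (c *: s + s') M = c *: X s M + X s' M) /\
  (forall s s' M, exists Y Y',
    [/\ has_dir_derivative (X s) M (X s' M) Y,
        has_dir_derivative (X s') M (X s M) Y'
      & Y - Y' = X (lie s s') M]).

Definition is_integral_curve (X : pot -> pot) (gamma : R -> pot) : Prop :=
  forall eps, has_derivative gamma eps (X (gamma eps)).

Definition is_group_action (A : Ggroup V -> pot -> pot) : Prop :=
  (forall M, A 1%g M = M) /\
  (forall S S' M, A (S * S')%g M = A S (A S' M)).

End Potentials.

(* Main.v *)
Require Import Defs.
From HB Require Import structures.
From mathcomp Require Import all_boot all_order all_algebra.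
From mathcomp.real_closed Require Import complex.
From mathcomp.multinomials Require Import -(notations) mpoly.
From mathcomp Require Import boolp classical_sets functions cardinality fsbigop.
From mathcomp Require Import reals topology normedtype derive realfun.
From mathcomp Require Import ring.

(** Collect M in the generating function M(x,y) = sum M_{a,b} x^a y^b and write
    s(u) = sum s_l u^l, the variable u standing for z^-1.  Since (x^l - (-y)^l)/(x+y) = sum_{a+b=l-1} (-1)^b x^a y^b,
    the vector field is

      s.M = s(x) M - M s(-y) + (s(x) - s(-y))/(x+y),

    that is, s acts on M + 1/(x+y) by left multiplication by s(x) minus right
    multiplication by s(-y).  To stay within power series, the three terms are
    treated as a left action (lact), a right action (ract) composed with the
    ring endomorphism u -> -u (ztwist), and a cocycle (cocycle), tied together by

      c(s t) = s c(t) + c(s) t(-y)                              (cocycleM).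

    Everything algebraic follows from this identity and from the fact that left
    and right multiplications commute: the bracket relation (act_lie), and the
    composition law (gact_is_action) of the group action

      S.M = S(x) M S(-y)^-1 + (S(x) - S(-y))/(x+y) S(-y)^-1     (gact).

    The master equations say that, for A(x) = 1 + x M(x,0) and
    B(y) = 1 + y M(0,y), one has 1 + (x+y) M = A(x) B(y), dM = A(x) dM(0,y) and
    dM = dM(x,0) B(y).  The action replaces A by S(x) A, B by B S(-y)^-1 and dM
    by S(x) dM S(-y)^-1, so the equations are kept (gact_master); the linearized
    statement (act_master) is the same computation to first order.

    Each coefficient of s.M at (a,b) involves M only at smaller a + b, since s
    starts at z^-1.  Hence the flow equation is triangular and an integral curve
    is determined by its initial value (integral_curve_unique).  By the product
    rule for End(V)-valued functions and (e^{rs})' = s e^{rs}, the curve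
    r |-> e^{rs}.M is an integral curve (gact_integral_curve); by uniqueness,
    e^s acts by the time-one flow.  Finally, e^s = S can be solved uniquely
    order by order in z^-1 (Gexp_inj, Gexp_surj). *)

Set Implicit Arguments.
Unset Strict Implicit.
Unset Printing Implicit Defensive.

Import Order.TTheory GRing.Theory Num.Theory.
Import numFieldNormedType.Exports.

Local Open Scope complex_scope.
Local Open Scope ring_scope.

(** * The ring of series in z^-1 and its exponential *)

Section ZSeries.
Variables (R : realType) (V : vectType R[i]).
Local Notation zser := (zseries V).
Implicit Types (s t : zser) (c : R[i]).

Lemma comp_lfun_suml I (r : seq I) (P : pred I) (F : I -> 'End(V)) (g : 'End(V)) :
  ((\sum_(i <- r | P i) F i) \o g = \sum_(i <- r | P i) (F i \o g))%VF.
Proof.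
by apply: (big_morph (fun f => f \o g)%VF) => [f h|]; rewrite ?comp_lfunDl ?comp_lfun0l.
Qed.

Lemma comp_lfun_sumr I (r : seq I) (P : pred I) (F : I -> 'End(V)) (g : 'End(V)) :
  (g \o (\sum_(i <- r | P i) F i) = \sum_(i <- r | P i) (g \o F i))%VF.
Proof.
by apply: (big_morph (fun f => g \o f)%VF) => [f h|]; rewrite ?comp_lfunDr ?comp_lfun0r.
Qed.

Lemma zscaleE c s k : (c *: s) k = c *: s k. Proof. by []. Qed.

Lemma zscalerAl c s t : c *: (s * t) = (c *: s) * t.
Proof.
apply/funext => k; rewrite zscaleE !zmulE scaler_sumr.
by apply: eq_bigr => i _; rewrite comp_lfunZl.
Qed.

Lemma zscalerAr c s t : c *: (s * t) = s * (c *: t).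
Proof.
apply/funext => k; rewrite zscaleE !zmulE scaler_sumr.
by apply: eq_bigr => i _; rewrite comp_lfunZr.
Qed.

Lemma zexprZ c s n : (c *: s) ^+ n = c ^+ n *: s ^+ n.
Proof.
elim: n => [|n IHn]; first by rewrite !expr0 scale1r.
by rewrite !exprS IHn -zscalerAl -zscalerAr scalerA.
Qed.

(** The substitution u -> -u for u = z^-1; it turns the right-hand factors S(-y) of the
    generating functions into elements of the same ring. *)
Definition ztwist s : zser := fun k => (-1) ^+ k *: s k.

Lemma ztwistM s t : ztwist (s * t) = ztwist s * ztwist t.
Proof.
apply/funext => k; rewrite /ztwist !zmulE scaler_sumr; apply: eq_bigr => i _.
rewrite -comp_lfunZl -comp_lfunZr scalerA -exprD subnKC //.
by rewrite -ltnS.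
Qed.

Lemma ztwistD s t : ztwist (s + t) = ztwist s + ztwist t.
Proof. by apply/funext => k; rewrite zaddE /ztwist -scalerDr. Qed.

Lemma ztwistZ c s : ztwist (c *: s) = c *: ztwist s.
Proof. by apply/funext => k; rewrite zscaleE /ztwist zscaleE !scalerA mulrC. Qed.

Lemma ztwist1 : ztwist 1 = 1.
Proof.
apply/funext => -[|k]; first by rewrite /ztwist scale1r.
by rewrite /ztwist -!/(zone V _) scaler0.
Qed.

(** Locality of the product: up to z^-k it only sees the factors up to z^-k,
    and one order less when the other factor starts at z^-1. *)
Lemma eq_zmul s s' t t' k :
    (forall j, (j <= k)%N -> s j = s' j) -> (forall j, (j <= k)%N -> t j = t' j) ->
  (s * t) k = (s' * t') k.
Proof.
move=> es et; rewrite !zmulE; apply: eq_bigr => i _.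
by rewrite es -1?ltnS // et // leq_subr.
Qed.

Lemma eq_zmul_lt s s' t t' k :
    s 0%N = 0 -> s' 0%N = 0 -> t 0%N = 0 -> t' 0%N = 0 ->
    (forall j, (j < k)%N -> s j = s' j) -> (forall j, (j < k)%N -> t j = t' j) ->
  (s * t) k = (s' * t') k.
Proof.
move=> s0 s0' t0 t0' es et; rewrite !zmulE; apply: eq_bigr => -[i /= ik] _.
have [->|i0] := posnP i; first by rewrite s0 s0' !comp_lfun0l.
have [->|ki] := eqVneq i k; first by rewrite subnn t0 t0' !comp_lfun0r.
have lik : (i < k)%N by rewrite ltn_neqAle ki -ltnS.
by rewrite es // et // ltn_subrL i0 (leq_trans _ lik).
Qed.

Lemma zexp_coefE s n k : s 0%N = 0 -> (k <= n)%N ->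
  zexp s k = \sum_(i < n.+1) (i`!%:R^-1 : R[i]) *: (s ^+ i) k.
Proof.
move=> s0 kn; rewrite /zexp.
rewrite (big_ord_widen n.+1 (fun i => (i`!%:R^-1 : R[i]) *: (s ^+ i) k)) //.
rewrite big_mkcond /=; apply: eq_bigr => i _.
by case: ltnP => // ki; rewrite zexp_low // scaler0.
Qed.

(** The terms of degree at least 2 in e^s see only the lower coefficients of s:
    this is what makes the equation e^s = S solvable, order by order. *)
Lemma zexp_sub_local s s' k : s 0%N = 0 -> s' 0%N = 0 ->
  (forall j, (j < k)%N -> s j = s' j) -> zexp s k - s k = zexp s' k - s' k.
Proof.
move=> s0 s0' es.
have expE (u : zser) : u 0%N = 0 -> zexp u k - u k =
    (1 : zser) k + \sum_(i < k) (i.+2`!%:R^-1 : R[i]) *: (u ^+ i.+2) k.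
  move=> u0; rewrite (zexp_coefE u0 (leqnSn k)) big_ord_recl big_ord_recl /=.
  by rewrite fact0 invr1 !scale1r expr0 expr1 [u k + _]addrC addrA addrK.
rewrite !expE //; congr (_ + _).
apply: eq_bigr => i _; congr (_ *: _).
have X0 (u : zser) : u 0%N = 0 -> forall n, (u ^+ n.+1) 0%N = 0.
  by move=> u0 n; rewrite exprS zmul0 u0 comp_lfun0l.
have eX : forall n j, (j < k)%N -> (s ^+ n) j = (s' ^+ n) j.
  elim=> [|n IHn] j jk; first by rewrite !expr0.
  rewrite !exprS; apply: eq_zmul => l lj; first exact/es/(leq_ltn_trans lj).
  exact/IHn/(leq_ltn_trans lj).
by rewrite exprS [in RHS]exprS; apply: eq_zmul_lt => //; rewrite ?X0 // => j; apply: eX.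
Qed.

Lemma Gexp_inj : injective (@Gexp R V).
Proof.
move=> s s' e; apply: val_inj; apply/funext => k /=.
elim/ltn_ind: k => k IHk.
have := zexp_sub_local (gminus0 s) (gminus0 s') IHk.
have -> : zexp s = zexp s' by exact: (congr1 (@Ggroup_val R V) e).
by move/addrI/oppr_inj.
Qed.

(** A logarithm of S is the fixed point of u |-> u + S - e^u, which is a
    contraction for the z^-1-adic topology; its z^-k coefficient is reached
    after k + 1 iterations. *)
Lemma Gexp_surj (S : Ggroup V) : exists s : gminus V, Gexp s = S.
Proof.
pose F (u : zser) : zser := fun k => if k is 0%N then 0 else Ggroup_val S k - (zexp u k - u k).
have F0 (u : zser) : F u 0%N = 0 by [].
have Floc (u u' : zser) k : u 0%N = 0 -> u' 0%N = 0 ->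
    (forall j, (j < k)%N -> u j = u' j) -> F u k = F u' k.
  by case: k => // k u0 u0' eu; rewrite /F (zexp_sub_local u0 u0' eu).
pose it n : zser := iter n F 0.
have it0 n : it n 0%N = 0 by case: n.
have itS n k : (k < n)%N -> it n k = it n.+1 k.
  elim: n k => // n IHn k kn; apply: Floc; rewrite ?it0 // => j jk.
  exact/IHn/(leq_trans jk).
have itE n k : (k < n)%N -> it n k = it k.+1 k.
  elim: n => // n IHn; rewrite ltnS leq_eqVlt => /predU1P[->//|kn].
  by rewrite -itS // IHn.
pose s : zser := fun k => it k.+1 k.
have s0 : s 0%N = 0 by [].
have sF k : s k = F s k.
  rewrite [LHS]/=; apply: Floc => // j jk.
  by rewrite -[LHS]/(it k j) itE.
have ks : in_gminus s by exact/eqP.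
exists (Gminus ks); apply: val_inj; apply/funext => -[|k] /=.
  by rewrite Ggroup0 /zexp big_ord1 fact0 invr1 scale1r.
have /eqP := sF k.+1; rewrite /F opprB addrCA -[X in X == _]addr0.
by rewrite (inj_eq (addrI _)) eq_sym subr_eq0 => /eqP <-.
Qed.

End ZSeries.

(** * Left and right actions on potentials, and the cocycle *)

Section Potentials.
Variables (R : realType) (V T : vectType R[i]).
Local Notation zser := (zseries V).
Local Notation tser := (tseries V T).
Local Notation pot := (gwpot V T).
Local Notation tc := (@tconst R V T).
Implicit Types (s t : zser) (c : R[i]) (M N : pot).

Lemma potP M N : (forall a b m, M a b m = N a b m) -> M = N.
Proof. by move=> eMN; do 3 (apply/funext => ?); apply: eMN. Qed.

Lemma potDE M N a b m : (M + N) a b m = M a b m + N a b m. Proof. by []. Qed.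
Lemma potNE M a b m : (- M) a b m = - M a b m. Proof. by []. Qed.
Lemma potZE c M a b m : (c *: M) a b m = c *: M a b m. Proof. by []. Qed.

(** For fixed other indices, the dependence of a potential on a, or on b, is an
    element of the ring of z-series; thus the module laws of the two actions
    below are the ring laws. *)
Definition pot_col M b m : zser := fun a => M a b m.
Definition pot_row M a m : zser := fun b => M a b m.

Definition lact s M : pot := fun a b m => (s * pot_col M b m) a.
Definition ract M s : pot := fun a b m => (pot_row M a m * s) b.
(** The generating function (s(x) - s(-y)) / (x + y), in the variables x, y
    marking a, b. *)
Definition cocycle s : pot := fun a b => (-1) ^+ b *: tc (s (a + b).+1).

Lemma lactE s M a b m : lact s M a b m = \sum_(i < a.+1) (s i \o M (a - i)%N b m)%VF.
Proof. by []. Qed.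

Lemma ractE s M a b m : ract M s a b m = \sum_(j < b.+1) (M a j m \o s (b - j)%N)%VF.
Proof. by []. Qed.

Lemma lactDr s M N : lact s (M + N) = lact s M + lact s N.
Proof.
apply: potP => a b m.
by rewrite /lact -[LHS]/((s * (pot_col M b m + pot_col N b m)) a) mulrDr.
Qed.
Lemma lactDl s t M : lact (s + t) M = lact s M + lact t M.
Proof. by apply: potP => a b m; rewrite /lact mulrDl. Qed.
Lemma lactN s M : lact s (- M) = - lact s M.
Proof. by apply: potP => a b m; rewrite /lact -[LHS]/((s * (- pot_col M b m)) a) mulrN. Qed.
Lemma lactNl s M : lact (- s) M = - lact s M.
Proof. by apply: potP => a b m; rewrite /lact mulNr. Qed.
Lemma lactZl c s M : lact (c *: s) M = c *: lact s M.
Proof. by apply: potP => a b m; rewrite /lact -zscalerAl. Qed.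
Lemma lactZr c s M : lact s (c *: M) = c *: lact s M.
Proof.
by apply: potP => a b m; rewrite /lact -[LHS]/((s * (c *: pot_col M b m)) a) -zscalerAr.
Qed.
Lemma lactM s t M : lact (s * t) M = lact s (lact t M).
Proof. by apply: potP => a b m; rewrite /lact -mulrA. Qed.
Lemma lact1 M : lact 1 M = M.
Proof. by apply: potP => a b m; rewrite /lact mul1r. Qed.

Lemma ractDl s M N : ract (M + N) s = ract M s + ract N s.
Proof.
apply: potP => a b m.
by rewrite /ract -[LHS]/(((pot_row M a m + pot_row N a m) * s) b) mulrDl.
Qed.
Lemma ractDr s t M : ract M (s + t) = ract M s + ract M t.
Proof. by apply: potP => a b m; rewrite /ract mulrDr. Qed.
Lemma ractN s M : ract (- M) s = - ract M s.
Proof. by apply: potP => a b m; rewrite /ract -[LHS]/(((- pot_row M a m) * s) b) mulNr. Qed.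
Lemma ractNr s M : ract M (- s) = - ract M s.
Proof. by apply: potP => a b m; rewrite /ract mulrN. Qed.
Lemma ractZl c s M : ract (c *: M) s = c *: ract M s.
Proof.
by apply: potP => a b m; rewrite /ract -[LHS]/(((c *: pot_row M a m) * s) b) -zscalerAl.
Qed.
Lemma ractZr c s M : ract M (c *: s) = c *: ract M s.
Proof. by apply: potP => a b m; rewrite /ract -zscalerAr. Qed.
Lemma ractM s t M : ract M (s * t) = ract (ract M s) t.
Proof. by apply: potP => a b m; rewrite /ract mulrA. Qed.
Lemma ract1 M : ract M 1 = M.
Proof. by apply: potP => a b m; rewrite /ract mulr1. Qed.

Lemma lact_ract s t M : lact s (ract M t) = ract (lact s M) t.
Proof.
apply: potP => a b m; rewrite lactE ractE.
under eq_bigr do rewrite ractE comp_lfun_sumr.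
rewrite exchange_big; apply: eq_bigr => j _; rewrite lactE comp_lfun_suml.
by apply: eq_bigr => i _; rewrite comp_lfunA.
Qed.

Lemma tconstE (A : 'End(V)) m : tc A m = if m == mnm0 then A else 0.
Proof. by []. Qed.

Lemma tconstD (A B : 'End(V)) : tc (A + B) = tc A + tc B.
Proof. by apply/funext => m; rewrite -[RHS]/(_ + _) !tconstE; case: eqP; rewrite ?addr0. Qed.

Lemma tconstZ c (A : 'End(V)) : tc (c *: A) = c *: tc A.
Proof. by apply/funext => m; rewrite -[RHS]/(_ *: _) !tconstE; case: eqP; rewrite ?scaler0. Qed.

Lemma tconst0 : tc (0 : 'End(V)) = 0.
Proof. by apply/funext => m; rewrite tconstE if_same. Qed.

Lemma cocycle1 : cocycle 1 = 0.
Proof. by apply/funext => a; apply/funext => b; rewrite /cocycle tconst0 scaler0. Qed.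

Lemma cocycleD s t : cocycle (s + t) = cocycle s + cocycle t.
Proof.
apply/funext => a; apply/funext => b.
by rewrite -[RHS]/(_ + _) /cocycle zaddE tconstD scalerDr.
Qed.

Lemma cocycleZ c s : cocycle (c *: s) = c *: cocycle s.
Proof.
apply/funext => a; apply/funext => b.
by rewrite -[RHS]/(_ *: _) /cocycle zscaleE tconstZ !scalerA mulrC.
Qed.

Lemma cocycleN s : cocycle (- s) = - cocycle s.
Proof. by rewrite -scaleN1r cocycleZ scaleN1r. Qed.

(** In generating functions this is the identity
    s(x) t(x) - s(-y) t(-y) = s(x) (t(x) - t(-y)) + (s(x) - s(-y)) t(-y)
    divided by x + y; in coefficients, the product splits according to whether
    the index of s exceeds a. *)
Lemma cocycleM s t : cocycle (s * t) = lact s (cocycle t) + ract (cocycle s) (ztwist t).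
Proof.
apply: potP => a b m; rewrite potDE lactE ractE.
rewrite /cocycle -[LHS]/(_ *: tc _ m) tconstE.
under eq_bigr do rewrite -[X in (_ \o X)%VF]/(_ *: tc _ m) tconstE.
under [X in _ + X]eq_bigr do rewrite -[X in (X \o _)%VF]/(_ *: tc _ m) tconstE.
case: (m == mnm0); last first.
  by rewrite scaler0 !big1 ?addr0 // => i _; rewrite ?scaler0 (comp_lfun0l, comp_lfun0r).
have -> : (s * t) (a + b).+1 =
    \sum_(i < a.+1 + b.+1) (s i \o t ((a + b).+1 - i)%N)%VF.
  by rewrite addSn addnS.
rewrite big_split_ord /= scalerDr; congr (_ + _); rewrite scaler_sumr; apply: eq_bigr => i _.
  rewrite -comp_lfunZr; congr (_ *: (_ \o t _)%VF).
  by rewrite -[RHS]addnS addnBAC ?addnS // -ltnS.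
have ib : (i <= b)%N by rewrite -ltnS.
rewrite /ztwist -comp_lfunZl -comp_lfunZr scalerA -exprD subnKC //.
by congr (_ *: (s _ \o t _)%VF); rewrite ?addSn // subSS subnDl.
Qed.

End Potentials.

(** * Products and derivatives of time series *)

Section TimeSeries.
Variables (R : realType) (V T : vectType R[i]).
Local Notation zser := (zseries V).
Local Notation tser := (tseries V T).
Local Notation pot := (gwpot V T).
Local Notation tc := (@tconst R V T).
Local Notation coc := (@cocycle R V T).
Implicit Types (s t : zser) (c : R[i]) (M N : pot) (f g : tser) (A : 'End(V)).

Lemma tserDE f g m : (f + g) m = f m + g m. Proof. by []. Qed.
Lemma potD2E M N a b : (M + N) a b = M a b + N a b. Proof. by []. Qed.
Lemma potN2E M a b : (- M) a b = - M a b. Proof. by []. Qed.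
Lemma tserZE c f m : (c *: f) m = c *: f m. Proof. by []. Qed.

Lemma tmul_constl A f : tmul (tc A) f = fun m => (A \o f m)%VF.
Proof.
apply/funext => m; rewrite /tmul.
have m0 : (mdeg (mnm0 : multinom (\dim {:T})) < (mdeg m).+1)%N by rewrite mdeg0.
rewrite (bigD1 (BMultinom m0, BMultinom (ltnSn (mdeg m)))) /=; last by rewrite add0m.
rewrite tconstE eqxx big1 ?addr0 // => -[[k kb] [l lb]] /= /andP[/eqP mkl].
rewrite xpair_eqE /= !bmeqP /= tconstE; case: (k =P mnm0) => [k0|]; last by rewrite comp_lfun0l.
by rewrite mkl k0 add0m !eqxx.
Qed.

Lemma tmul_constr f A : tmul f (tc A) = fun m => (f m \o A)%VF.
Proof.
apply/funext => m; rewrite /tmul.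
have m0 : (mdeg (mnm0 : multinom (\dim {:T})) < (mdeg m).+1)%N by rewrite mdeg0.
rewrite (bigD1 (BMultinom (ltnSn (mdeg m)), BMultinom m0)) /=; last by rewrite addm0.
rewrite tconstE eqxx big1 ?addr0 // => -[[k kb] [l lb]] /= /andP[/eqP mkl].
rewrite xpair_eqE /= !bmeqP /= tconstE; case: (l =P mnm0) => [k0|]; last by rewrite comp_lfun0r.
by rewrite mkl k0 addm0 !eqxx.
Qed.

Lemma tmulDl f g h : tmul (f + g) h = tmul f h + tmul g h.
Proof.
apply/funext => m; rewrite tserDE /tmul -big_split /=.
by apply: eq_bigr => k _; rewrite tserDE comp_lfunDl.
Qed.

Lemma tmulDr f g h : tmul f (g + h) = tmul f g + tmul f h.
Proof.
apply/funext => m; rewrite tserDE /tmul -big_split /=.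
by apply: eq_bigr => k _; rewrite tserDE comp_lfunDr.
Qed.

Lemma tmulNr f g : tmul f (- g) = - tmul f g.
Proof.
apply/eqP; rewrite -addr_eq0 -tmulDr addNr; apply/eqP/funext => m.
by rewrite /tmul big1 // => k _; rewrite comp_lfun0r.
Qed.

(** Left multiplications by constants commute with right multiplications, so
    the two actions are linear over the products of time series. *)
Lemma lact_tmul s M (g : nat -> tser) a b b0 :
  lact s (fun a b => tmul (M a b0) (g b)) a b = tmul (lact s M a b0) (g b).
Proof.
apply/funext => m; rewrite lactE /tmul.
under [RHS]eq_bigr do rewrite lactE comp_lfun_suml.
rewrite [RHS]exchange_big /=; apply: eq_bigr => i _; rewrite comp_lfun_sumr.
by apply: eq_bigr => k _; rewrite comp_lfunA.
Qed.

Lemma ract_tmul s M (f : nat -> tser) a b a0 :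
  ract (fun a b => tmul (f a) (M a0 b)) s a b = tmul (f a) (ract M s a0 b).
Proof.
apply/funext => m; rewrite ractE /tmul.
under [RHS]eq_bigr do rewrite ractE comp_lfun_sumr.
rewrite [RHS]exchange_big /=; apply: eq_bigr => i _; rewrite comp_lfun_suml.
by apply: eq_bigr => k _; rewrite comp_lfunA.
Qed.

Lemma lact_shift s M a b :
  lact s M a.+1 b = lact s (fun a b => M a.+1 b) a b + tmul (tc (s a.+1)) (M 0%N b).
Proof.
apply/funext => m; rewrite tserDE tmul_constl !lactE big_ord_recr /= subnn.
by congr (_ + _); apply: eq_bigr => i _; rewrite subSn // -ltnS.
Qed.

Lemma ract_shift s M a b :
  ract M s a b.+1 = ract (fun a b => M a b.+1) s a b + tmul (M a 0%N) (tc (s b.+1)).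
Proof.
apply/funext => m; rewrite tserDE tmul_constr !ractE big_ord_recl /= subn0 addrC.
by congr (_ + _); apply: eq_bigr => i _; rewrite /bump /= add1n subSS.
Qed.

(** The sum of the two shifts is the division of (x + y) M by x y, up to boundary
    terms; these combine with the rows b = 0 and a = 0 of the cocycle, which are
    (s(x) - s(0))/x and (s(0) - s(-y))/y. *)
Lemma lact_shift_sum s M a b : lact s M a.+1 b + lact s M a b.+1 =
  lact s (fun a b => M a.+1 b + M a b.+1) a b + tmul (tc (s a.+1)) (M 0%N b).
Proof.
rewrite lact_shift addrAC; congr (_ + _); apply/funext => m.
rewrite tserDE !lactE -big_split /=.
by apply: eq_bigr => i _; rewrite tserDE comp_lfunDr.
Qed.

Lemma ract_shift_sum s M a b : ract M s a.+1 b + ract M s a b.+1 =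
  ract (fun a b => M a.+1 b + M a b.+1) s a b + tmul (M a 0%N) (tc (s b.+1)).
Proof.
rewrite ract_shift addrA; congr (_ + _); apply/funext => m.
rewrite tserDE !ractE -big_split /=.
by apply: eq_bigr => i _; rewrite tserDE comp_lfunDl.
Qed.

Lemma lact_a0 s M b : lact s M 0%N b = tmul (tc (s 0%N)) (M 0%N b).
Proof. by apply/funext => m; rewrite tmul_constl lactE big_ord1. Qed.

Lemma ract_b0 s M a : ract M s a 0%N = tmul (M a 0%N) (tc (s 0%N)).
Proof. by apply/funext => m; rewrite tmul_constr ractE big_ord1. Qed.

Lemma cocycle_b0 s a : coc s a 0%N = tc (s a.+1).
Proof. by rewrite /cocycle scale1r addn0. Qed.

Lemma cocycle_a0 s b : coc s 0%N b = - tc (ztwist s b.+1).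
Proof. by rewrite /cocycle add0n /ztwist tconstZ exprS mulN1r scaleNr opprK. Qed.

(** Away from the boundary, (x + y) kills the cocycle, because s(x) - s(-y) has no
    mixed monomials. *)
Lemma cocycle_shift s a b : coc s a.+1 b + coc s a b.+1 = 0.
Proof. by rewrite /cocycle addSn addnS exprS mulN1r scaleNr addrN. Qed.

Definition dpot v M : pot := fun a b => tdiff (M a b) v.

Lemma dpotE v M a b m : dpot v M a b m =
  \sum_(j < \dim {:T}) coord (vbasis {:T}) j v *:
     ((m j).+1%:R *: M a b (mnm_add m (mnm1 j))).
Proof.
rewrite /dpot /tdiff; set r := index_enum _.
by apply: (big_morph (fun h : tser => h m)).
Qed.

Lemma dpotD v M N : dpot v (M + N) = dpot v M + dpot v N.
Proof.
apply: potP => a b m; rewrite potDE !dpotE -big_split /=.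
by apply: eq_bigr => j _; rewrite potDE !scalerDr.
Qed.

Lemma dpotN v M : dpot v (- M) = - dpot v M.
Proof.
apply: potP => a b m; rewrite potNE !dpotE -sumrN.
by apply: eq_bigr => j _; rewrite potNE !scalerN.
Qed.

Lemma dpot_lact v s M : dpot v (lact s M) = lact s (dpot v M).
Proof.
apply: potP => a b m; rewrite dpotE lactE.
under eq_bigr do rewrite lactE !scaler_sumr.
rewrite exchange_big; apply: eq_bigr => i _; rewrite dpotE comp_lfun_sumr.
by apply: eq_bigr => j _; rewrite -!comp_lfunZr.
Qed.

Lemma dpot_ract v s M : dpot v (ract M s) = ract (dpot v M) s.
Proof.
apply: potP => a b m; rewrite dpotE ractE.
under eq_bigr do rewrite ractE !scaler_sumr.
rewrite exchange_big; apply: eq_bigr => i _; rewrite dpotE comp_lfun_suml.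
by apply: eq_bigr => j _; rewrite -!comp_lfunZl.
Qed.

Lemma dpot_cocycle v s : dpot v (coc s) = 0.
Proof.
apply: potP => a b m; rewrite dpotE big1 // => j _.
rewrite /cocycle tserZE tconstE; case: eqP => [/mnmP/(_ j)|_].
  by rewrite mnmDE mnm1E eqxx mnm0E addn1.
by rewrite !scaler0.
Qed.

End TimeSeries.

(** * The Lie algebra action *)

Section LieAction.
Variables (R : realType) (V T : vectType R[i]).
Local Notation zser := (zseries V).
Local Notation tser := (tseries V T).
Local Notation pot := (gwpot V T).
Local Notation tc := (@tconst R V T).
Local Notation coc := (@cocycle R V T).
Implicit Types (c : R[i]) (M N : pot).

Lemma act_termE (s : gminus V) M a b l : act_term s M a b l =
  (if (l <= a)%N then fun m => (gminus_val s l \o M (a - l)%N b m)%VF else 0)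
  - (if (l <= b)%N then fun m => (M a (b - l)%N m \o ztwist s l)%VF else 0)
  + (if l == (a + b).+1 then coc s a b else 0).
Proof.
rewrite /act_term tmul_constl tmul_constr addn1; congr (_ - _ + _).
- by case: ifP => // _; apply/funext => m; rewrite comp_lfun0r.
- case: ifP => // _; apply/funext => m; rewrite tserZE ?comp_lfunZr //.
  by rewrite comp_lfun0l.
- by rewrite eq_sym; case: eqP => [->|_]; rewrite ?mulr1n // mulr0n scale0r.
Qed.

(** Beyond l = a + b + 1 both shifted indices are negative and the constant term
    has passed: this is why the sum over l is finite. *)
Lemma act_term_high (s : gminus V) M a b l :
  ((a + b).+1 < l)%N -> act_term s M a b l = 0.
Proof.
move=> abl; rewrite act_termE (gtn_eqF abl).
rewrite ![(l <= _)%N]leqNgt !(leq_trans _ abl) ?subr0 ?addr0 //.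
  by rewrite ltnS leqW // leq_addl.
by rewrite ltnS leqW // leq_addr.
Qed.

Lemma act_term0 (s : gminus V) M a b : act_term s M a b 0 = 0.
Proof.
rewrite act_termE /= addr0; apply/funext => m.
rewrite -[LHS]/(_ - _) /ztwist gminus0 scaler0 comp_lfun0l comp_lfun0r.
by rewrite subrr.
Qed.

Lemma act_support_finite (s : gminus V) M a b : finite_set (act_support s M a b).
Proof.
apply: (sub_finite_set _ (finite_II (a + b).+2)) => l [_ nz] /=.
by rewrite ltnNge; apply/negP => abl; apply: nz; apply: act_term_high.
Qed.

(** The missing term l = 0 vanishes because s starts at z^-1, so the sums over l
    are full convolutions, and the constant term is a single coefficient. *)
Lemma actE (s : gminus V) M : act s M = lact s M - ract M (ztwist s) + cocycle s.
Proof.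
apply: potP => a b m.
have -> : act s M a b = \sum_(l < (a + b).+2) act_term s M a b l.
  rewrite -(big_mkord xpredT (act_term s M a b)) big_ltn // act_term0 add0r.
  rewrite /act (fsbigE (index_iota 1 (a + b).+2)) ?iota_uniq //; first last.
  - move=> l /= l1; rewrite mem_index_iota l1 /= -leqNgt; exact: act_term_high.
  - by move=> l /=; rewrite mem_index_iota => /andP[].
  rewrite big_seq_cond [RHS]big_seq_cond; apply: eq_bigl => l.
  by rewrite mem_index_iota andbT; case: (ltnP 0 l) => //= l1; rewrite mem_set ?andbT.
under eq_bigr do rewrite act_termE.
rewrite big_split sumrB /= -!big_mkcond /= (big_ord1_eq _ (fun=> coc s a b)) ltnS leqnn.
rewrite -[RHS]/(_ - _ + _) -[LHS]/(_ - _ + _).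
have sumE I (r : seq I) (P : pred I) (F : I -> tser) :
    (\sum_(i <- r | P i) F i) m = \sum_(i <- r | P i) F i m.
  by apply: (big_morph (fun h : tser => h m)).
congr (_ - _ + _).
  rewrite sumE lactE.
  rewrite (big_ord_widen (a + b).+2 (fun l => (gminus_val s l \o M (a - l)%N b m)%VF)) //.
  by rewrite ltnS leqW // leq_addr.
rewrite sumE ractE [RHS](reindex_inj rev_ord_inj) /=.
under [RHS]eq_bigr => j _ do rewrite subSS subKn -1?ltnS //.
rewrite (big_ord_widen (a + b).+2 (fun l => (M a (b - l)%N m \o ztwist s l)%VF)) //.
by rewrite ltnS leqW // leq_addl.
Qed.

Lemma act_linear c (s s' : gminus V) M : act (c *: s + s') M = c *: act s M + act s' M.
Proof.
rewrite !actE -[gminus_val (c *: s + s')]/(c *: gminus_val s + gminus_val s').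
rewrite lactDl lactZl ztwistD ztwistZ ractDr ractZr cocycleD cocycleZ.
by rewrite !scalerDr scalerN opprD [LHS](AC (2*2*2) ((1*3*5)*(2*4*6))).
Qed.

(** The vector field act s is affine, so this is its derivative at every M. *)
Definition dact (s : zser) M : pot := lact s M - ract M (ztwist s).

Lemma dactD s M N : dact s (M + N) = dact s M + dact s N.
Proof. by rewrite /dact lactDr ractDl opprD addrACA. Qed.
Lemma dactZ c s M : dact s (c *: M) = c *: dact s M.
Proof. by rewrite /dact lactZr ractZl scalerBr. Qed.

Lemma act_affine (s : gminus V) M N : act s (M + N) = act s M + dact s N.
Proof. by rewrite !actE -!/(dact s _) dactD addrAC. Qed.

(** Left and right factors commute and the twist is multiplicative, so the
    linear part is a representation of the commutator bracket. *)
Lemma dact_commutator (s s' : zser) M :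
  dact s (dact s' M) - dact s' (dact s M) = dact (s * s' - s' * s) M.
Proof.
rewrite /dact.
have ztB : ztwist (s * s' - s' * s) = ztwist s * ztwist s' - ztwist s' * ztwist s.
  by rewrite ztwistD -scaleN1r ztwistZ scaleN1r !ztwistM.
rewrite ztB lactDl lactNl !lactM ractDr ractNr !ractM.
rewrite !lactDr !lactN !ractDl !ractN !lact_ract.
rewrite !opprD !opprK !addrA.
by rewrite [LHS](ACl ((((1*5)*8)*4)*(3*6)*(2*7))) /= !addNr !addr0.
Qed.

(** The terms linear in M are dact_commutator; the constant ones add up to the
    cocycle of s s' - s' s by cocycleM, applied to both products. *)
Lemma act_lie (s s' : gminus V) M :
  dact s (act s' M) - dact s' (act s M) = act (lie s s') M.
Proof.
have actD (u : gminus V) : act u M = dact u M + coc u by rewrite actE.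
rewrite !actD !(dactD _ (dact _ _)) opprD addrACA dact_commutator; congr (_ + _).
rewrite /= cocycleD cocycleN !cocycleM /dact opprD opprK !opprD.
by rewrite [LHS](AC (2*2) ((1*4)*(3*2))).
Qed.

End LieAction.

(** * The group action and the master equations *)

Section MasterEquations.
Variables (R : realType) (V T : vectType R[i]).
Local Notation zser := (zseries V).
Local Notation tser := (tseries V T).
Local Notation pot := (gwpot V T).
Local Notation tc := (@tconst R V T).
Local Notation coc := (@cocycle R V T).
Implicit Types (c : R[i]) (M N : pot).

Lemma tmul_tc0l (f : tser) : tmul (tc 0) f = 0.
Proof. by rewrite tmul_constl; apply/funext => m; rewrite comp_lfun0l. Qed.
Lemma tmul_tc0r (f : tser) : tmul f (tc 0) = 0.
Proof. by rewrite tmul_constr; apply/funext => m; rewrite comp_lfun0r. Qed.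
Lemma tmul_tc1l (f : tser) : tmul (tc \1%VF) f = f.
Proof. by rewrite tmul_constl; apply/funext => m; rewrite comp_lfun1l. Qed.
Lemma tmul_tc1r (f : tser) : tmul f (tc \1%VF) = f.
Proof. by rewrite tmul_constr; apply/funext => m; rewrite comp_lfun1r. Qed.

(** The master equations in index-free form: they identify the shifts of M and
    dM with products, so that the actions can be pushed through them. *)
Lemma master_shift M : master_equations M -> [/\
  forall v, (fun a b => dpot v M a.+1 b) = fun a b => tmul (M a 0%N) (dpot v M 0%N b),
  forall v, (fun a b => dpot v M a b.+1) = fun a b => tmul (dpot v M a 0%N) (M 0%N b)
  & (fun a b => M a.+1 b + M a b.+1) = fun a b => tmul (M a 0%N) (M 0%N b)].
Proof.
move=> ME; split=> [v|v|]; apply/funext => a; apply/funext => b; have [e1 e2 e3] := ME a b.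
- exact: e1.
- exact: e2.
- exact: e3.
Qed.

(** Writing N = s.M, one has N_{a,0} = (s M)_{a,0} + s_{a+1}: the cocycle supplies
    exactly the boundary term that appears when s(x) M is shifted in a, and
    symmetrically in b. *)
Lemma act_master (s : gminus V) M :
  master_equations M -> linearized_master_equations M (act s M).
Proof.
move=> ME; have s0 := gminus0 s.
have zs0 : ztwist s 0%N = 0 by rewrite /ztwist s0 scaler0.
have actab a b : act s M a b = lact s M a b - ract M (ztwist s) a b + coc s a b.
  by rewrite actE !potD2E potN2E.
have Na a : act s M a 0%N = lact s M a 0%N + tc (gminus_val s a.+1).
  by rewrite actab ract_b0 zs0 tmul_tc0r subr0 cocycle_b0.
have Nb b : act s M 0%N b = - (ract M (ztwist s) 0%N b + tc (ztwist s b.+1)).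
  by rewrite actab lact_a0 s0 tmul_tc0l sub0r cocycle_a0 opprD.
have dN v : dpot v (act s M) = lact s (dpot v M) - ract (dpot v M) (ztwist s).
  by rewrite actE !dpotD dpotN dpot_cocycle addr0 dpot_lact dpot_ract.
have dNa v a : dpot v (act s M) a 0%N = lact s (dpot v M) a 0%N.
  by rewrite dN potD2E potN2E ract_b0 zs0 tmul_tc0r subr0.
have dNb v b : dpot v (act s M) 0%N b = - ract (dpot v M) (ztwist s) 0%N b.
  by rewrite dN potD2E potN2E lact_a0 s0 tmul_tc0l sub0r.
have [E1 E2 E3] := master_shift ME.
move=> a b; split=> [v|v|].
- change (dpot v (act s M) a.+1 b = tmul (act s M a 0%N) (dpot v M 0%N b)
      + tmul (M a 0%N) (dpot v (act s M) 0%N b)).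
  rewrite dNb tmulNr dN potD2E potN2E lact_shift E1 lact_tmul -tmulDl -Na.
  congr (_ - _).
  by rewrite -ract_tmul -[LHS]/(ract (fun a b => dpot v M a.+1 b) _ a b) E1.
- change (dpot v (act s M) a b.+1 = tmul (dpot v (act s M) a 0%N) (M 0%N b)
      + tmul (dpot v M a 0%N) (act s M 0%N b)).
  rewrite dNa Nb tmulNr dN potD2E potN2E ract_shift E2 ract_tmul -tmulDr.
  congr (_ - _).
  by rewrite -lact_tmul -[LHS]/(lact s (fun a b => dpot v M a b.+1) a b) E2.
- rewrite Na Nb tmulNr !actab (AC (3*3) ((1*4)*(2*5)*(3*6))) /= cocycle_shift addr0 -opprD.
  by rewrite lact_shift_sum ract_shift_sum E3 lact_tmul ract_tmul -tmulDl -tmulDr.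
Qed.

(** The image of M + 1/(x+y) under S(x) _ S(-y)^-1, minus 1/(x+y). *)
Definition gact (S : Ggroup V) M : pot :=
  ract (lact (Ggroup_val S) M + cocycle (Ggroup_val S)) (ztwist (Ggroup_val S^-1%g)).

Lemma Ggroup_mulV (S : Ggroup V) : Ggroup_val S * Ggroup_val S^-1%g = 1.
Proof. by have /(congr1 (@Ggroup_val R V)) := mulgV S. Qed.

Lemma Ggroup_Vmul (S : Ggroup V) : Ggroup_val S^-1%g * Ggroup_val S = 1.
Proof. by have /(congr1 (@Ggroup_val R V)) := mulVg S. Qed.

Lemma gact_is_action : is_group_action gact.
Proof.
split=> [M|S S' M].
  rewrite /gact invg1 -[Ggroup_val 1%g]/(1 : zser) lact1 cocycle1 addr0 ztwist1.
  exact: ract1.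
rewrite /gact invgM.
rewrite -[Ggroup_val (S * S')%g]/(Ggroup_val S * Ggroup_val S').
rewrite -[Ggroup_val (S'^-1 * S^-1)%g]/(Ggroup_val S'^-1%g * Ggroup_val S^-1%g).
rewrite ztwistM ractM lactM cocycleM lact_ract lactDr; congr (ract _ _).
rewrite addrA [in LHS]ractDl; congr (_ + _).
by rewrite -ractM -ztwistM Ggroup_mulV ztwist1 ract1.
Qed.

(** The action is the composite of M |-> L = S(x) M + (S(x) - S(-y))/(x+y), which
    replaces the factor A(x) = 1 + x M(x,0) by S(x) A(x), and of the right
    multiplication by t = S(-y)^-1, which turns B(y) = 1 + y M(0,y) into B(y) t(y). *)
Lemma gact_master (S : Ggroup V) M : master_equations M -> master_equations (gact S M).
Proof.
move=> ME; set s := Ggroup_val S; set t := ztwist (Ggroup_val S^-1%g).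
have s0 : s 0%N = \1%VF by exact: Ggroup0.
have t0 : t 0%N = \1%VF by rewrite /t /ztwist Ggroup0 scale1r.
pose L := lact s M + coc s.
have gE : gact S M = ract L t by [].
have Lab a b : L a b = lact s M a b + coc s a b by rewrite /L potD2E.
have La a : L a 0%N = lact s M a 0%N + tc (s a.+1).
  by rewrite Lab cocycle_b0.
have ga a : ract L t a 0%N = L a 0%N by rewrite ract_b0 t0 tmul_tc1r.
(* By cocycleM for S S^-1 = 1, c(S) t is minus S c(S^-1), whose row a = 0 is
   (1 - t(y))/y because S starts with the identity. *)
have gb b : ract L t 0%N b = ract M t 0%N b + tc (t b.+1).
  have sV : ract (coc s) t = - lact s (coc (Ggroup_val S^-1%g)).
    by symmetry; apply: addr0_eq; rewrite -cocycleM Ggroup_mulV cocycle1.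
  rewrite ractDl sV potD2E potN2E -lact_ract !lact_a0 s0 !tmul_tc1l cocycle_a0.
  by rewrite opprK.
have dL v : dpot v L = lact s (dpot v M) by rewrite dpotD dpot_cocycle addr0 dpot_lact.
have dg v : dpot v (ract L t) = ract (lact s (dpot v M)) t by rewrite dpot_ract dL.
have dga v a : dpot v (ract L t) a 0%N = lact s (dpot v M) a 0%N.
  by rewrite dg ract_b0 t0 tmul_tc1r.
have dgb v b : dpot v (ract L t) 0%N b = ract (dpot v M) t 0%N b.
  by rewrite dg -lact_ract lact_a0 s0 tmul_tc1l.
have [E1 E2 E3] := master_shift ME.
have F1 v : (fun a b => lact s (dpot v M) a.+1 b) = fun a b => tmul (L a 0%N) (dpot v M 0%N b).
  apply/funext => a; apply/funext => b.
  by rewrite lact_shift E1 lact_tmul -tmulDl -La.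
have F2 v : (fun a b => lact s (dpot v M) a b.+1) =
    fun a b => tmul (lact s (dpot v M) a 0%N) (M 0%N b).
  apply/funext => a; apply/funext => b.
  by rewrite -lact_tmul -[LHS]/(lact s (fun a b => dpot v M a b.+1) a b) E2.
have F3 : (fun a b => L a.+1 b + L a b.+1) = fun a b => tmul (L a 0%N) (M 0%N b).
  apply/funext => a; apply/funext => b.
  by rewrite !Lab addrACA cocycle_shift addr0 lact_shift_sum E3 lact_tmul -tmulDl -La.
move=> a b; rewrite gE; split=> [v|v|].
- change (dpot v (ract L t) a.+1 b = tmul (ract L t a 0%N) (dpot v (ract L t) 0%N b)).
  rewrite dgb ga -ract_tmul dg.
  by rewrite -[LHS]/(ract (fun a b => lact s (dpot v M) a.+1 b) t a b) F1.
- change (dpot v (ract L t) a b.+1 = tmul (dpot v (ract L t) a 0%N) (ract L t 0%N b)).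
  by rewrite dga gb dg ract_shift F2 ract_tmul -tmulDr.
- by rewrite ga gb ract_shift_sum F3 ract_tmul -tmulDr.
Qed.

End MasterEquations.

(** * Derivatives of vector-valued functions *)

Section Calculus.
Variable R : realType.
Implicit Types (F G : R -> R[i]) (c d : R[i]).

(** Complex-valued functions of a real variable, differentiated through their
    real and imaginary parts. *)
Definition cder F (x : R) c : Prop :=
  is_derive x 1 (fun y => complex.Re (F y)) (complex.Re c) /\
  is_derive x 1 (fun y => complex.Im (F y)) (complex.Im c).

Lemma ReD c d : complex.Re (c + d) = complex.Re c + complex.Re d.
Proof. by case: c; case: d. Qed.
Lemma ImD c d : complex.Im (c + d) = complex.Im c + complex.Im d.
Proof. by case: c; case: d. Qed.
Lemma ReM c d :
  complex.Re (c * d) = complex.Re c * complex.Re d - complex.Im c * complex.Im d.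
Proof. by case: c; case: d. Qed.
Lemma ImM c d :
  complex.Im (c * d) = complex.Re c * complex.Im d + complex.Im c * complex.Re d.
Proof. by case: c; case: d. Qed.

Lemma cder_cst c x : cder (fun=> c) x 0.
Proof. by split; exact: is_derive_cst. Qed.

Lemma cderD F G x c d : cder F x c -> cder G x d -> cder (fun y => F y + G y) x (c + d).
Proof.
move=> [Fr Fi] [Gr Gi]; split.
  by under eq_fun do rewrite ReD; rewrite ReD; exact: is_deriveD.
by under eq_fun do rewrite ImD; rewrite ImD; exact: is_deriveD.
Qed.

Lemma cderM F G x c d :
  cder F x c -> cder G x d -> cder (fun y => F y * G y) x (c * G x + F x * d).
Proof.
move=> [Fr Fi] [Gr Gi]; split.
  under eq_fun do rewrite ReM.
  have D := is_deriveB (is_deriveM Fr Gr) (is_deriveM Fi Gi).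
  apply: (is_derive_eq D).
  rewrite ReD !ReM /GRing.scale /=; ring.
under eq_fun do rewrite ImM.
have D := is_deriveD (is_deriveM Fr Gi) (is_deriveM Fi Gr).
apply: (is_derive_eq D).
rewrite ImD !ImM /GRing.scale /=; ring.
Qed.

Lemma cder_sum I (r : seq I) (F : I -> R -> R[i]) x (c : I -> R[i]) :
  (forall i, cder (F i) x (c i)) ->
  cder (fun y => \sum_(i <- r) F i y) x (\sum_(i <- r) c i).
Proof.
move=> dF; elim: r => [|i r IHr].
  by rewrite big_nil; under eq_fun do rewrite big_nil; exact: cder_cst.
by rewrite big_cons; under eq_fun do rewrite big_cons; exact: cderD.
Qed.

Lemma cder_real x : cder (fun y => y%:C) x 1.
Proof. by split; [exact: is_derive_id | exact: is_derive_cst]. Qed.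

Lemma cderX n x : cder (fun y => y%:C ^+ n) x (n%:R * x%:C ^+ n.-1).
Proof.
elim: n => [|n IHn].
  by under eq_fun do rewrite expr0; rewrite mul0r; exact: cder_cst.
under eq_fun do rewrite exprS.
have -> : n.+1%:R * x%:C ^+ n.+1.-1 = 1 * x%:C ^+ n + x%:C * (n%:R * x%:C ^+ n.-1).
  rewrite mul1r mulrCA -natr1 mulrDl mul1r addrC; congr (_ + _).
  by case: n {IHn} => [|n]; rewrite ?mul0r // exprS.
exact: cderM (cder_real x) IHn.
Qed.

Lemma cder0_cst F : (forall x, cder F x 0) -> forall x y, F x = F y.
Proof.
move=> dF x y.
have := is_derive_0_is_cst x y (fun z => proj1 (dF z)).
have := is_derive_0_is_cst x y (fun z => proj2 (dF z)).
by case: (F x) (F y) => [a b] [a' b'] /= -> ->.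
Qed.

Lemma linear_hom (U W : vectType R[i]) (h : U -> W) :
  linear h -> exists g : 'Hom(U, W), g =1 h.
Proof.
move=> lin; pose l := GRing.isLinear.Build R[i] U W *:%R h lin.
pose h' : {linear U -> W} := HB.pack h l.
exists (linfun h') => u; exact: lfunE.
Qed.

Section VectorValued.
Variable U : vectType R[i].
Implicit Types (f g : R -> U) (u v : U).

(** The derivative of a vector-valued function, tested on linear functionals as in
    the definition of the derivative of a curve of potentials. *)
Definition vder f (x : R) v : Prop :=
  forall phi : 'Hom(U, R[i]^o), cder (fun y => phi (f y)) x (phi v).

Lemma vder_coord n (e : n.-tuple U) i f x v :
  vder f x v -> cder (fun y => coord e i (f y)) x (coord e i v).
Proof.
have [|phi phiE] := @linear_hom U R[i]^o (coord e i).
  by move=> c u w; rewrite linearP.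
by move=> /(_ phi); rewrite phiE; under eq_fun do rewrite phiE.
Qed.

Lemma vder_cst v x : vder (fun=> v) x 0.
Proof. by move=> phi; rewrite linear0; exact: cder_cst. Qed.

Lemma vderD f g x u v : vder f x u -> vder g x v -> vder (fun y => f y + g y) x (u + v).
Proof.
move=> df dg phi; under eq_fun do rewrite linearD; rewrite linearD.
by apply: cderD; [exact: df | exact: dg].
Qed.

Lemma vder_sum I (r : seq I) (f : I -> R -> U) x (v : I -> U) :
  (forall i, vder (f i) x (v i)) ->
  vder (fun y => \sum_(i <- r) f i y) x (\sum_(i <- r) v i).
Proof.
move=> df phi; under eq_fun do rewrite linear_sum.
by rewrite linear_sum; apply: cder_sum => i; exact: df.
Qed.

Lemma vderZ F f x c v :
  cder F x c -> vder f x v -> vder (fun y => F y *: f y) x (c *: f x + F x *: v).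
Proof.
move=> dF df phi; under eq_fun do rewrite linearZ.
by rewrite linearD !linearZ; apply: cderM => //; exact: df.
Qed.

Lemma vderZl F x c v : cder F x c -> vder (fun y => F y *: v) x (c *: v).
Proof.
move=> dF; have := vderZ dF (vder_cst v x).
by rewrite scaler0 addr0.
Qed.

Lemma vderN f x v : vder f x v -> vder (fun y => - f y) x (- v).
Proof.
move=> df; have := vderZ (cder_cst (-1) x) df.
by rewrite scale0r add0r scaleN1r; under eq_fun do rewrite scaleN1r.
Qed.

(** Coordinates are linear functionals, so the functionals separate points. *)
Lemma vder0_cst f : (forall x, vder f x 0) -> forall x y, f x = f y.
Proof.
move=> df x y; rewrite (coord_vbasis (memvf (f x))) (coord_vbasis (memvf (f y))).
apply: eq_bigr => i _; congr (_ *: _).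
apply: (cder0_cst (F := fun z => coord (vbasis fullv) i (f z))) => z.
by have := vder_coord (vbasis fullv) i (df z); rewrite linear0.
Qed.

End VectorValued.

Lemma vder_linear (U W : vectType R[i]) (h : U -> W) (f : R -> U) x v :
  linear h -> vder f x v -> vder (fun y => h (f y)) x (h v).
Proof.
move=> /linear_hom[g gE] df phi; have := df (phi \o g)%VF.
by rewrite comp_lfunE gE; under eq_fun do rewrite comp_lfunE gE.
Qed.

(** Expanding one factor in a basis reduces this to products of complex-valued
    functions. *)
Lemma vder_comp (V : vectType R[i]) (f g : R -> 'End(V)) x u v :
  vder f x u -> vder g x v ->
  vder (fun y => (f y \o g y)%VF) x ((u \o g x)%VF + (f x \o v)%VF).
Proof.
move=> df dg.
pose e := vbasis {: 'End(V)}.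
have compE (a b : 'End(V)) : (a \o b = \sum_i coord e i a *: (e`_i \o b))%VF.
  rewrite {1}(coord_vbasis (memvf a)) comp_lfun_suml.
  by apply: eq_bigr => i _; rewrite -comp_lfunZl.
under eq_fun do rewrite compE.
rewrite !compE -big_split /=; apply: vder_sum => i.
apply: vderZ; first exact: vder_coord.
apply: (vder_linear (h := fun b => (e`_i \o b)%VF)) => // c a b.
by rewrite comp_lfunDr comp_lfunZr.
Qed.

End Calculus.

(** * The flow of s *)

Section Flow.
Variables (R : realType) (V T : vectType R[i]).
Local Notation zser := (zseries V).
Local Notation pot := (gwpot V T).
Local Notation coc := (@cocycle R V T).
Implicit Types (s t : zser) (M N : pot) (f g : R -> zser) (gamma : R -> pot).

Definition zder f (x : R) s : Prop := forall k, vder (fun y => f y k) x (s k).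

Lemma has_derivativeP gamma x N :
  has_derivative gamma x N <-> forall a b m, vder (fun y => gamma y a b m) x (N a b m).
Proof. by []. Qed.

Lemma zderM f g x s t : zder f x s -> zder g x t ->
  zder (fun y => f y * g y) x (s * g x + f x * t).
Proof.
move=> df dg k; rewrite zaddE !zmulE -big_split /=; under eq_fun do rewrite zmulE.
by apply: vder_sum => i; apply: vder_comp.
Qed.

Lemma zder_twist f x s : zder f x s -> zder (fun y => ztwist (f y)) x (ztwist s).
Proof.
move=> df k; have := vderZ (cder_cst ((-1) ^+ k) x) (df k).
by rewrite scale0r add0r.
Qed.

Lemma has_derivativeD gamma1 gamma2 x N1 N2 :
  has_derivative gamma1 x N1 -> has_derivative gamma2 x N2 ->
  has_derivative (fun y => gamma1 y + gamma2 y) x (N1 + N2).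
Proof.
by move=> d1 d2; apply/has_derivativeP => a b m; apply: vderD; [exact: d1|exact: d2].
Qed.

Lemma has_derivative_cst M x : has_derivative (fun=> M) x 0.
Proof. by apply/has_derivativeP => a b m; exact: vder_cst. Qed.

Lemma has_derivative_lact f gamma x s N :
  zder f x s -> has_derivative gamma x N ->
  has_derivative (fun y => lact (f y) (gamma y)) x (lact s (gamma x) + lact (f x) N).
Proof.
move=> df dg; apply/has_derivativeP => a b m.
have dcol : zder (fun y => pot_col (gamma y) b m) x (pot_col N b m).
  by move=> k; exact: dg.
exact: (zderM df dcol).
Qed.

Lemma has_derivative_ract f gamma x s N :
  zder f x s -> has_derivative gamma x N ->
  has_derivative (fun y => ract (gamma y) (f y)) x (ract N (f x) + ract (gamma x) s).
Proof.
move=> df dg; apply/has_derivativeP => a b m.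
have drow : zder (fun y => pot_row (gamma y) a m) x (pot_row N a m).
  by move=> k; exact: dg.
exact: (zderM drow df).
Qed.

Lemma has_derivative_cocycle f x s : zder f x s -> has_derivative (fun y => coc (f y)) x (coc s).
Proof.
move=> df; apply/has_derivativeP => a b m.
have := vderZ (cder_cst (if m == mnm0 then (-1) ^+ b else 0) x) (df (a + b).+1).
rewrite scale0r add0r.
have e (u : 'End(V)) : (if m == mnm0 then (-1) ^+ b else 0) *: u =
    ((-1) ^+ b *: @tconst R V T u) m.
  by rewrite tserZE tconstE; case: eqP; rewrite ?scale0r ?scaler0.
by rewrite e; under eq_fun do rewrite e.
Qed.

(** The coefficients of e^s up to z^-n are those of this element of the ring, which
    gives access to the ring laws. *)
Definition zexp_trunc s n : zser := \sum_(i < n.+1) (i`!%:R^-1 : R[i]) *: s ^+ i.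

Lemma zexp_truncE s n k : s 0%N = 0 -> (k <= n)%N -> zexp s k = zexp_trunc s n k.
Proof. by move=> s0 kn; rewrite (zexp_coefE s0 kn) /zexp_trunc zsumE. Qed.

Lemma zexp_comm s t : t 0%N = 0 -> s * t = t * s -> s * zexp t = zexp t * s.
Proof.
move=> t0 st; apply/funext => k.
have eT j : (j <= k)%N -> zexp t j = zexp_trunc t k j by exact: zexp_truncE.
rewrite (@eq_zmul _ _ s s (zexp t) (zexp_trunc t k)) //.
rewrite (@eq_zmul _ _ (zexp t) (zexp_trunc t k) s s) //.
rewrite /zexp_trunc mulr_sumr mulr_suml !zsumE; apply: eq_bigr => i _.
by rewrite -zscalerAl -zscalerAr (commrX i st).
Qed.

(** If P is the series of e^(ys) truncated after s^k, then dP/dy and s P differ by a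
    multiple of s^(k+1), which starts at z^-(k+1) and does not contribute to the
    coefficient of z^-k. *)
Lemma zder_exp s x : s 0%N = 0 ->
  zder (fun y => zexp (y%:C *: s)) x (s * zexp (x%:C *: s)).
Proof.
move=> s0 k; have xs0 (y : R[i]) : (y *: s) 0%N = 0 by rewrite zscaleE s0 scaler0.
have -> : (s * zexp (x%:C *: s)) k =
    \sum_(n < k.+1) ((n`!%:R^-1 : R[i]) * (n%:R * x%:C ^+ n.-1)) *: (s ^+ n) k.
  rewrite (@eq_zmul _ _ s s _ (zexp_trunc (x%:C *: s) k)) //; last first.
    by move=> j; exact: zexp_truncE.
  rewrite /zexp_trunc mulr_sumr zsumE big_ord_recr big_ord_recl /=.
  rewrite mul0r mulr0 scale0r add0r zexprZ -!zscalerAr -exprS !zscaleE.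
  rewrite zexp_low // !scaler0 addr0; apply: eq_bigr => i _.
  rewrite zexprZ -!zscalerAr -exprS !zscaleE scalerA; congr (_ *: _).
  rewrite /bump /= add1n factS natrM invfM -mulrA mulrCA; congr (_ * _).
  by rewrite mulrA mulVf ?mul1r // pnatr_eq0.
apply: vder_sum => n.
under eq_fun do rewrite zexprZ zscaleE scalerA.
apply: vderZl.
have := cderM (cder_cst (n`!%:R^-1) x) (cderX n x).
by rewrite mul0r add0r.
Qed.

Lemma zexp0 : zexp (0 : zser) = 1.
Proof.
apply/funext => k; rewrite /zexp big_ord_recl /= fact0 invr1 scale1r expr0.
by rewrite big1 ?addr0 // => i _; rewrite expr0n scaler0.
Qed.

(** The derivative of e^(ys) e^(-ys) vanishes because s commutes with e^(ys). *)
Lemma zexp_mulN s : s 0%N = 0 -> zexp s * zexp (- s) = 1.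
Proof.
move=> s0; have ns0 : (- s) 0%N = 0 by rewrite zoppE s0 oppr0.
pose f y := zexp (y%:C *: s) * zexp (y%:C *: (- s)).
have df x : zder f x 0.
  have := zderM (zder_exp x s0) (zder_exp x ns0).
  have xs0 : (x%:C *: s) 0%N = 0 by rewrite zscaleE s0 scaler0.
  set E := zexp (x%:C *: s); set E' := zexp _.
  have -> : s * E * E' + E * (- s * E') = 0.
    have -> : s * E = E * s by apply: zexp_comm => //; rewrite -zscalerAl -zscalerAr.
    by rewrite mulNr mulrN mulrA addrN.
  by [].
have f01 : f 1 = f 0.
  by apply/funext => k; exact: (vder0_cst (f := fun y => f y k) (fun x => df x k)).
move: f01; rewrite /f !scale1r !scale0r zexp0 mulr1 => <-.
by [].
Qed.

Lemma GexpV (s : gminus V) : Ggroup_val (Gexp s)^-1%g = zexp (- gminus_val s).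
Proof.
rewrite -[LHS]mulr1 -(zexp_mulN (gminus0 s)) mulrA.
by rewrite -[zexp (gminus_val s)]/(Ggroup_val (Gexp s)) Ggroup_Vmul mul1r.
Qed.

(** With E = e^(rs) and E' = e^(-rs) at time r, differentiating S(x) = E gives the left
    multiplication by s(x), and differentiating S(-y)^-1 = E'(-y) gives the right
    multiplication by -s(-y).  The constant term comes from the derivative
    c(s E) = s c(E) + c(s) E(-y) of the cocycle, where E(-y) cancels E'(-y). *)
Lemma gact_integral_curve (s : gminus V) M :
  is_integral_curve (act s) (fun y => gact (Gexp (y%:C *: s)) M).
Proof.
move=> x; have s0 := gminus0 s.
have ns0 : (- gminus_val s) 0%N = 0 by rewrite zoppE s0 oppr0.
pose E y := zexp (y%:C *: gminus_val s).
pose E' y := zexp (y%:C *: - gminus_val s).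
have gE y : gact (Gexp (y%:C *: s)) M = ract (lact (E y) M + cocycle (E y)) (ztwist (E' y)).
  by rewrite /gact GexpV /E' scalerN.
have dE : zder E x (gminus_val s * E x) by exact: zder_exp.
have dE' : zder (fun y => ztwist (E' y)) x (- (ztwist (E' x) * ztwist s)).
  rewrite -ztwistM -[- ztwist _]scaleN1r -ztwistZ scaleN1r -mulrN.
  rewrite -zexp_comm; first by have := zder_twist (zder_exp x ns0).
    by rewrite zscaleE ns0 scaler0.
  by rewrite -zscalerAl -zscalerAr.
have EE' : ztwist (E x) * ztwist (E' x) = 1.
  rewrite -ztwistM /E' scalerN zexp_mulN ?ztwist1 //.
  by rewrite zscaleE s0 scaler0.
have dL := has_derivativeD (has_derivative_lact dE (has_derivative_cst M x))
  (has_derivative_cocycle dE).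
have := has_derivative_ract dE' dL.
have lact0 (u : zser) : lact u (0 : pot) = 0.
  by apply: (addrI (lact u 0)); rewrite -lactDr !addr0.
rewrite lact0 addr0 -/(E x) -/(E' x).
set L := lact (E x) M + cocycle (E x).
suff -> : ract (lact (gminus_val s * E x) M + cocycle (gminus_val s * E x)) (ztwist (E' x))
    + ract L (- (ztwist (E' x) * ztwist s)) = act s (ract L (ztwist (E' x))).
  rewrite /L -gE; congr (has_derivative _ x _).
  by apply/funext => y; rewrite gE.
rewrite ractNr ractM actE addrAC; congr (_ - _).
(* The constant c(s) is written as c(s) E(-y) E'(-y), to match cocycleM. *)
rewrite lact_ract [X in _ = _ + X](_ : _ = ract (ract (cocycle s) (ztwist (E x))) (ztwist (E' x))).
  by rewrite -ractDl lactDr lactM cocycleM addrA.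
by rewrite -ractM EE' ract1.
Qed.

Lemma act_local (s : gminus V) M N a b :
  (forall a' b', (a' + b' < a + b)%N -> M a' b' = N a' b') -> act s M a b = act s N a b.
Proof.
move=> eMN; apply/funext => m; rewrite !actE; have s0 := gminus0 s.
congr (_ - _ + _).
  rewrite !lactE !big_ord_recl /= s0 !comp_lfun0l; congr (_ + _); apply: eq_bigr => i _.
  rewrite eMN // ltn_add2r ltn_subrL /=.
  exact: leq_trans (ltn_ord i).
rewrite !ractE !big_ord_recr /= subnn /ztwist s0 scaler0 !comp_lfun0r; congr (_ + _).
by apply: eq_bigr => i _; rewrite eMN // ltn_add2l.
Qed.

(** The coefficients of the vector field at (a, b) only involve those of M at
    smaller a + b, so the flow equation is triangular. *)
Lemma integral_curve_unique (s : gminus V) (gamma1 gamma2 : R -> pot) :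
  is_integral_curve (act s) gamma1 -> is_integral_curve (act s) gamma2 ->
  gamma1 0 = gamma2 0 -> gamma1 = gamma2.
Proof.
move=> d1 d2 e0.
suff e n a b : (a + b < n)%N -> forall x, gamma1 x a b = gamma2 x a b.
  by apply/funext => x; do 2 (apply/funext => ?); apply: e (leqnn _) _.
elim: n a b => // n IHn a b; rewrite ltnS => abn x; apply/funext => m.
have df y : vder (fun z => gamma1 z a b m + - gamma2 z a b m) y 0.
  rewrite -(subrr (act s (gamma1 y) a b m)).
  apply: vderD; first exact: (d1 y a b m).
  rewrite (_ : act s (gamma1 y) a b = act s (gamma2 y) a b).
    by apply: vderN; exact: (d2 y a b m).
  by apply: act_local => a' b' lt; apply: IHn; exact: leq_trans abn.
apply/eqP; rewrite -subr_eq0; apply/eqP.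
by have /= -> := vder0_cst df x 0; rewrite e0 subrr.
Qed.

Lemma act_dir_derivative (s : gminus V) M N :
  has_dir_derivative (act s) M N (dact s N).
Proof.
apply/has_derivativeP => a b m.
have D : vder (fun y : R => act s M a b m + y%:C *: dact s N a b m) 0
    (0 + 1 *: dact s N a b m).
  by apply: vderD; [exact: vder_cst | apply: vderZl; exact: cder_real].
move: D; rewrite add0r scale1r.
by under eq_fun do rewrite -potZE -potDE -dactZ -act_affine.
Qed.

End Flow.

(** * Exponential map and time-one flows *)

Section Integration.
Variables (R : realType) (V T : vectType R[i]).
Local Notation pot := (gwpot V T).

Lemma gact_flow0 (s : gminus V) (M : pot) : gact (Gexp (0%:C *: s)) M = M.
Proof.
rewrite scale0r (_ : Gexp 0 = 1%g); first by have [-> _] := gact_is_action V T.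
by apply: val_inj; exact: zexp0.
Qed.

(** By uniqueness of integral curves, gamma is the curve r |-> e^(rs).gamma(0). *)
Lemma gact_time_one (s : gminus V) (gamma : R -> pot) :
  is_integral_curve (act s) gamma -> gact (Gexp s) (gamma 0) = gamma 1.
Proof.
move=> dgamma.
rewrite (integral_curve_unique dgamma (gact_integral_curve s (gamma 0))).
  by rewrite gact_flow0 scale1r.
by rewrite gact_flow0.
Qed.

Lemma Gexp_bij : bijective (@Gexp R V).
Proof.
have [log logK] := choice (@Gexp_surj R V).
by exists log => // s; apply: Gexp_inj; rewrite logK.
Qed.

End Integration.

(** * The theorem *)

Theorem theorem3p2 (R : realType) (V T : vectType R[i]) :
  (* s.M is well defined *)
  (forall (s : gminus V) (M : gwpot V T) (a b : nat),
     finite_set (act_support s M a b)) /\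
  (* it is a Lie algebra action *)
  is_lie_action (@act R V T) /\
  (* which preserves the master equations *)
  (forall (s : gminus V) (M : gwpot V T),
     master_equations M -> linearized_master_equations M (act s M)) /\
  (* exp : g_- -> G_- is bijective and the flows exist and are unique, so that
     "time-one flow of s" is well defined and depends only on e^s *)
  bijective (@Gexp R V) /\
  (forall (s : gminus V) (M : gwpot V T),
     exists! gamma : R -> gwpot V T,
       is_integral_curve (act s) gamma /\ gamma 0 = M) /\
  (* these time-one flows form a group action, preserving the master equations *)
  exists A : Ggroup V -> gwpot V T -> gwpot V T,
    [/\ is_group_action A,
        forall (s : gminus V) (gamma : R -> gwpot V T),
          is_integral_curve (act s) gamma -> A (Gexp s) (gamma 0) = gamma 1
      & forall (S : Ggroup V) (M : gwpot V T),
          master_equations M -> master_equations (A S M)].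
Proof.
split; first exact: act_support_finite.
split; first split; first by move=> c s s' M; exact: act_linear.
  move=> s s' M; exists (dact s (act s' M)), (dact s' (act s M)).
  by split; [exact: act_dir_derivative | exact: act_dir_derivative | exact: act_lie].
split; first by move=> s M; exact: act_master.
split; first exact: Gexp_bij.
split.
  move=> s M; exists (fun y => gact (Gexp (y%:C *: s)) M).
  split; first by split; [exact: gact_integral_curve | exact: gact_flow0].
  move=> gamma [dgamma gamma0]; apply: (integral_curve_unique _ dgamma).
    exact: gact_integral_curve.
  by rewrite gact_flow0 gamma0.
exists (@gact R V T); split.
- exact: gact_is_action.
- exact: gact_time_one.
- exact: gact_master.
Qed.
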